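(* Let $T$ be a hypercyclic continuous linear operator on a complex topological vector space $X$. Let $G$ be an abelian compact topological group, let $P\in\mathbb Z[t]$ and let $g\in G$ be such that $\{g^{P(n)};\ n\geq 1\}$ is dense in $G$. Then $\{(T^n x,g^{P(n)});\ n\geq 1\}$ is dense in $X\times G$ for every $x\in HC(T)$.
   Context: A continuous linear operator $T$ on $X$ is hypercyclic if there exists $x\in X$ whose orbit $\{T^n x;\ n\geq 0\}$ is dense in $X$; such an $x$ is called a hypercyclic vector for $T$, and $HC(T)$ denotes the set of hypercyclic vectors for $T$. *)

(* Defs.v *)
From mathcomp Require Import all_boot all_order all_algebra.
From mathcomp Require Import all_classical all_reals all_analysis.
From mathcomp Require Export complex.

Set Implicit Arguments.
Unset Strict Implicit.
Unset Printing Implicit Defensive.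

Local Open Scope classical_set_scope.

(* A complex topological vector space is a [topologicalLmodType R[i]] with
   [R : realType]. The library's [tvsType] is not used because it requires local
   convexity. Linearity and continuity of [T] are kept out of these definitions;
   they are imposed on the operator itself. *)

Definition orbit (X : topologicalType) (T : X -> X) (x : X) : set X :=
  [set iter n T x | n in [set: nat]].

Definition HC (X : topologicalType) (T : X -> X) : set X :=
  [set x | dense (orbit T x)].

Definition hypercyclic (X : topologicalType) (T : X -> X) : Prop :=
  exists x : X, HC T x.

(* Main.v *)
Require Import Defs.
From mathcomp Require Import all_boot all_order all_algebra.
From mathcomp Require Import all_classical all_reals all_analysis.
From mathcomp Require Import ring lra zify.

Set Implicit Arguments.
Unset Strict Implicit.
Unset Printing Implicit Defensive.

Import Order.TTheory GRing.Theory Num.Theory numFieldNormedType.Exports.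
Local Open Scope classical_set_scope.
Local Open Scope ring_scope.

(** Fix [x] in [HC T]. By density of the [g^P(N)] it suffices to follow one
    target [g^P(N)]; replacing [x] by [T^N x] and [P] by [Q = P(. + N) - P(N)],
    which vanishes at 0, one looks for [n] with [T^n x] in a given open set [V]
    and [g^Q(n)] in a given neighbourhood [U] of the identity.

    The compact group is eliminated first. If [W + W - W - W] lies in [U], the
    set [E] of integers [k] with [g^k] in [W] has bounded gaps because [G] is
    compact, and Bogolyubov's theorem ([bogolyubov]) says that [E + E - E - E]
    contains every [k] whose products with finitely many reals [theta] are all
    within 1/4 of an integer. So it suffices to find [n] such that [T^n x] is in
    [V] and all the [Q(n) theta] are close to integers, hence it suffices to
    make the finitely many [n^j theta], with [j] at least 1, close to integers.

    These phases [n^j theta] are brought under control one at a time, by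
    increasing [j]. Suppose that the [n] for which the earlier phases are almost
    integers still send every hypercyclic vector into every open set; such [n]
    are the large sets of a [recurrence_filter]. Let [psi] be the next phase;
    modulo the earlier ones it is almost additive. For [x] and [y] in [X], the
    set [limit_phases x y] of limits modulo 1 of [psi n], when [T^n x] tends to
    [y] along the filter, behaves like the set of arrows from [x] to [y] in a
    groupoid. In particular [H = limit_phases x x] is a closed subgroup of the
    reals. If [H] is dense, every phase is reached. Otherwise [H] is discrete,
    and [y] |-> [limit_phases x y] is a continuous map from [HC T] to the circle
    [R / H]. Since [p(T) x] is hypercyclic for every nonzero
    polynomial [p] ([HC_polyop]), this map is defined on the triangles with
    vertices [x], [T^k x], [T^(k+1) x]. A triangle is simply connected, so that
    the variation of the phase from [x] to [T^(k+1) x] is the variation from [x]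
    to [T^k x] plus the one from [T^k x] to [T^(k+1) x], and the latter equals
    the one from [x] to [T x] because [T^k] commutes with [T]. Hence the
    variation from [x] to [T^n x] is [n] times the variation from [x] to [T x].
    But [T^n x] returns arbitrarily close to [x], where the phase varies little.
    So the variation from [x] to [T x] is arbitrarily small, the phase of
    [T x] is that of [x], and by density 0 belongs to every [limit_phases x y]
    ([limit_phases0]). This is the statement needed to add [psi] to the phases
    under control ([recurrence_filter_extend]). *)

(** * Topological vector spaces *)

Lemma continuous_scale (K : numFieldType) (X : topologicalLmodType K)
    (A : topologicalType) (f : A -> K^o) (g : A -> X) :
  continuous f -> continuous g -> continuous (fun a => f a *: g a).
Proof.
move=> cf cg a; apply: (@continuous_comp A (K^o * X)%type X (fun a => (f a, g a))
  (fun z => z.1 *: z.2)).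
  exact: (cvg_pair (cf a) (cg a)).
exact: scale_continuous.
Qed.

Lemma continuous_add (X : topologicalZmodType) (A : topologicalType) (f g : A -> X) :
  continuous f -> continuous g -> continuous (fun a => f a + g a).
Proof.
move=> cf cg a; apply: (@continuous_comp A (X * X)%type X (fun a => (f a, g a))
  (fun z => z.1 + z.2)).
  exact: (cvg_pair (cf a) (cg a)).
exact: add_continuous.
Qed.

Lemma continuous_cst (A B : topologicalType) (b : B) : continuous (fun a : A => b).
Proof. move=> a; exact: cvg_cst. Qed.

Lemma nbhs_addr (X : topologicalZmodType) (x y : X) (A : set X) :
  nbhs (y + x) A -> nbhs y [set u | A (u + x)].
Proof.
have : continuous (fun u : X => u + x).
  by apply: continuous_add; [move=> ?; exact: cvg_id|exact: continuous_cst].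
by move=> /(_ y A) h yA; exact: h.
Qed.

(** The conclusion is a balanced neighbourhood in disguise: the unit disc times
    [W] stays in [U]. It makes the segments from [x] to nearby points stay near
    [x]. *)
Lemma nbhs0_balanced (K : numFieldType) (X : topologicalLmodType K) (U : set X) :
  nbhs 0 U ->
  exists2 W : set X, nbhs 0 W & forall (b : K) w, `|b| <= 1 -> W w -> U (b *: w).
Proof.
move=> U0; have := @scale_continuous _ X (0:K^o,0:X) U; rewrite /= scale0r => /(_ U0).
case=> -[B W] [/= /nbhs_ballP [e /= e0 Be] W0] BWU.
pose c : K := e / 2.
have c0 : 0 < c by rewrite divr_gt0.
have ce : c < e by rewrite /c [X in _ < X](splitr e) ltrDl.
exists [set w | W (c^-1 *: w)].
  have : continuous (fun w : X => c^-1 *: w).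
    apply: (@continuous_scale _ X X (fun=> c^-1)) => [|x].
      exact: continuous_cst.
    exact: cvg_id.
  by move=> /(_ 0 W); rewrite /= scaler0; apply.
move=> b w b1 /= Ww.
have -> : b *: w = (b * c) *: (c^-1 *: w) by rewrite scalerA mulfK ?gt_eqF.
apply: (BWU (b * c, c^-1 *: w)); split => //=; apply: Be.
have bc : `|b * c| <= c by rewrite normrM (gtr0_norm c0) ler_piMl // ltW.
by rewrite /ball /= sub0r normrN; exact: le_lt_trans bc ce.
Qed.

(** * Polynomials in a hypercyclic operator *)

Section Hyper.
Variables (K : numClosedFieldType) (X : topologicalLmodType K).
Variables (T : {linear X -> X}) (T_continuous : continuous T).

Lemma continuous_iter n : continuous (iter n T).
Proof.
elim: n => [|n IHn] x; first exact: cvg_id.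
by apply: (@continuous_comp X X X (iter n T) T); [exact: IHn|exact: T_continuous].
Qed.

Definition polyop (p : {poly K}) (y : X) : X :=
  \sum_(i < size p) p`_i *: iter i T y.

Implicit Types (p q : {poly K}) (x y : X).

Lemma polyop_widen p n y : (size p <= n)%N ->
  polyop p y = \sum_(i < n) p`_i *: iter i T y.
Proof.
move=> pn; rewrite /polyop (big_ord_widen n (fun i => p`_i *: iter i T y)) //.
rewrite big_mkcond; apply: eq_bigr => i _; case: ltnP => // ip.
by rewrite nth_default ?scale0r.
Qed.

Lemma polyopD p q y : polyop (p + q) y = polyop p y + polyop q y.
Proof.
pose n := maxn (size p) (size q).
rewrite (@polyop_widen _ n) ?size_polyD// (@polyop_widen p n) ?leq_maxl//.
rewrite (@polyop_widen q n) ?leq_maxr// -big_split; apply: eq_bigr => i _ /=.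
by rewrite coefD scalerDl.
Qed.

Lemma polyopZ a p y : polyop (a *: p) y = a *: polyop p y.
Proof.
rewrite (@polyop_widen _ (size p)) ?size_scale_leq// scaler_sumr.
by apply: eq_bigr => i _; rewrite coefZ scalerA.
Qed.

Lemma polyop_Xn n y : polyop 'X^n y = iter n T y.
Proof.
rewrite /polyop size_polyXn big_ord_recr /= coefXn eqxx scale1r big1 ?add0r// => i _.
by rewrite coefXn ltn_eqF// scale0r.
Qed.

Lemma iterT_sum I (r : seq I) (P : pred I) (F : I -> X) n :
  iter n T (\sum_(i <- r | P i) F i) = \sum_(i <- r | P i) iter n T (F i).
Proof. by elim: n => // n IHn; rewrite iterS IHn raddf_sum. Qed.

Lemma iterTZ n a y : iter n T (a *: y) = a *: iter n T y.
Proof. by elim: n => // n IHn; rewrite iterS IHn linearZ. Qed.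

Lemma iterTB n y z : iter n T (y - z) = iter n T y - iter n T z.
Proof. by elim: n => // n IHn; rewrite iterS IHn linearB. Qed.

Lemma polyop_iter p n y : polyop p (iter n T y) = iter n T (polyop p y).
Proof.
rewrite /polyop iterT_sum; apply: eq_bigr => i _.
by rewrite iterTZ -!iterD addnC.
Qed.

Lemma polyopMX p y : polyop ('X * p) y = T (polyop p y).
Proof.
rewrite (@polyop_widen _ (size p).+1); last first.
  by have [->|p0] := eqVneq p 0; rewrite ?mulr0 ?size_poly0// mulrC size_mulX.
rewrite big_ord_recl coefXM /= scale0r add0r /polyop raddf_sum.
by apply: eq_bigr => i _; rewrite coefXM /= linearZ.
Qed.

Lemma continuous_polyop p : continuous (polyop p).
Proof.
rewrite /polyop; elim: (size p) => [|n IHn].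
  under eq_fun do rewrite big_ord0; exact: continuous_cst.
under eq_fun do rewrite big_ord_recr /=.
apply: continuous_add => //.
apply: (@continuous_scale _ _ _ (fun=> p`_n)); [exact: continuous_cst|exact: continuous_iter].
Qed.

Lemma HC_image (L : X -> X) x : continuous L -> dense (range L) ->
  (forall y, L (T y) = T (L y)) -> HC T x -> HC T (L x).
Proof.
move=> cL dL LT HCx O O0 oO.
have [z0 [Oy [y _ yE]]] := dL O O0 oO.
have oLO : open (L @^-1` O) by apply: open_comp => // z _; exact: cL.
have LO0 : L @^-1` O !=set0 by exists y; rewrite /= yE.
have [z1 [LOn [n _ nE]]] := HCx _ LO0 oLO.
exists (L (iter n T x)); split; first by rewrite nE.
exists n => //; elim: n {nE} => //= n ->; by rewrite LT.
Qed.

Lemma dense_comp (f g : X -> X) : continuous g ->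
  dense (range f) -> dense (range g) -> dense (range (g \o f)).
Proof.
move=> cg df dg O O0 oO.
have [z0 [Oy [y _ yE]]] := dg O O0 oO.
have ogO : open (g @^-1` O) by apply: open_comp => // z _; exact: cg.
have gO0 : g @^-1` O !=set0 by exists y; rewrite /= yE.
have [z1 [gOz [z _ zE]]] := df _ gO0 ogO.
by exists (g (f z)); split; [rewrite zE|exists z].
Qed.

(** Modulo the closure of the range of [T - a], the operator [T] acts as the
    scalar [a]. If the quotient were nonzero, the class of [x] would have a dense
    orbit [a^n x] in it, so that the powers [a^n] would be dense in the scalars,
    which is impossible whether [|a| <= 1] or [|a| > 1]. In the proof a
    neighbourhood of [x] that misses the range plays the role of a functional
    which vanishes on it. *)
Lemma dense_range_sub_eigen x a : HC T x -> dense (range (fun y => T y - a *: y)).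
Proof.
move=> HCx; set S := fun y => _.
have [xcl|] := pselect (closure (range S) x).
  (* The range is T-invariant, hence so is its closure, which contains the orbit. *)
  move=> O O0 oO; have [z0 [On [n _ nE]]] := HCx O O0 oO.
  have /xcl [z1 [[z _ zE] Oz]] : nbhs x (iter n T @^-1` O).
    by apply: continuous_iter; apply: open_nbhs_nbhs; rewrite nE.
  exists (iter n T (S z)); rewrite zE; split => //; rewrite -zE; exists (iter n T z) => //.
  by rewrite /S iterTB iterTZ -iterS iterSr.
rewrite /closure /= => /existsNP [B /not_implyP [Bx RB]]; exfalso.
have [W W0 WB] : exists2 W : set X, nbhs 0 W &
    forall b w, `|b| <= 1 -> W w -> B (b *: w + x).
  have : nbhs (0 : X) [set u | B (u + x)] by apply: nbhs_addr; rewrite add0r.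
  by move=> /nbhs0_balanced.
have SD y z : S (y + z) = S y + S z.
  by rewrite /S linearD scalerDr opprD addrACA.
have SZ c y : S (c *: y) = c *: S y.
  by rewrite /S (linearZ_LR T) scalerBr !scalerA mulrC.
have ST y : S (T y) = T (S y) by rewrite /S (linearB T) (linearZ_LR T).
(* Modulo the range, [W] contains only multiples [c x] with [|c| < 1]. *)
have coef_lt1 c w z : W w -> w - c *: x = S z -> `|c| < 1.
  move=> Ww wE.
  have cr : `|c| \is Num.real by exact: normr_real.
  case: (real_ltP cr (real1 _)) => // c1; exfalso; apply: RB.
  have c0 : c != 0 by rewrite -normr_gt0 (lt_le_trans ltr01).
  exists ((- c^-1) *: w + x); split; last first.
    by apply: WB => //; rewrite normrN normfV invf_le1// normr_gt0.
  exists (- c^-1 *: z) => //.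
  rewrite SZ.
  by rewrite -wE scalerBr scalerA mulNr mulVf// scaleN1r opprK.
have iterS_ n : exists z, iter n T x - a ^+ n *: x = S z.
  elim: n => [|n [z zE]].
    by exists 0; rewrite /S linear0 scaler0 expr0 scale1r !subrr.
  exists (T z + a ^+ n *: x).
  rewrite SD SZ ST -zE /S (linearB T) (linearZ_LR T) /= scalerBr addrA subrK.
  by rewrite scalerA -exprSr.
have close mu : exists n, `|a ^+ n - mu| < 1.
  have : nbhs (mu *: x) [set u | W (u - mu *: x)] by apply: nbhs_addr; rewrite subrr.
  rewrite nbhsE => -[N [oN Nx] NW].
  have [|z1 [Nn [n _ nE]]] := HCx N _ oN; first by exists (mu *: x).
  exists n; have [z zE] := iterS_ n.
  apply: (coef_lt1 _ (iter n T x - mu *: x) z); first by apply: NW; rewrite nE.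
  by rewrite -zE scalerBl opprB addrA subrK.
have [||a1|a1] := @real_leP _ `|a| 1; [exact: normr_real|exact: real1| |].
  have [n] := close 2; rewrite distrC => h.
  have an : `|a ^+ n| <= 1 by rewrite normrX exprn_ile1.
  have := ler_normD (2 - a ^+ n) (a ^+ n).
  rewrite subrK ger0_norm// => h2.
  by have := le_lt_trans h2 (ltr_leD h an); rewrite -[1 + 1]/(2 : K) ltxx.
have [n] := close 0; rewrite subr0 normrX => h.
by have := le_lt_trans (exprn_ege1 n (ltW a1)) h; rewrite ltxx.
Qed.

(** Over an algebraically closed field [p(T)] is a product of operators [T - z],
    which all have dense range. *)
Lemma dense_range_polyop x p : HC T x -> p != 0 -> dense (range (polyop p)).
Proof.
move=> HCx; have [r ->] := closed_field_poly_normal p.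
set c := lead_coef p => p0.
have c0 : c != 0 by apply: contraNneq p0 => ->; rewrite scale0r.
have Tr z q : polyop (('X - z%:P) * q) = (fun y => T y - z *: y) \o polyop q.
  apply/funext => y /=; rewrite mulrBl polyopD polyopMX -scaleN1r polyopZ mul_polyC polyopZ.
  by rewrite scaleN1r.
have Sc q : polyop (c *: q) = (fun y => c *: y) \o polyop q.
  by apply/funext => y /=; rewrite polyopZ.
have cc : continuous (fun y : X => c *: y).
  by apply: (@continuous_scale _ X X (fun=> c)) => [|y]; [exact: continuous_cst|exact: cvg_id].
rewrite Sc; apply: dense_comp => //; last first.
  move=> O [y Oy] _; exists y; split => //; exists (c^-1 *: y) => //.
  by rewrite scalerA divff// scale1r.
elim: r {p0} => [|z r IHr].
  rewrite big_nil -(expr0 'X) => O [y Oy] _; exists y; split=> //; exists y => //.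
  by rewrite polyop_Xn.
rewrite big_cons Tr; apply: dense_comp => //; last exact: dense_range_sub_eigen HCx.
apply: (@continuous_add X X T (fun y => - (z *: y))) => // y.
under eq_fun do rewrite -scaleNr.
by apply: (@continuous_scale _ X X (fun=> - z)) => [|w]; [exact: continuous_cst|exact: cvg_id].
Qed.

(** The orbit of [p(T) x] is the image of a dense orbit under a map with dense
    range. *)
Lemma HC_polyop x p : HC T x -> p != 0 -> HC T (polyop p x).
Proof.
move=> HCx p0; apply: HC_image => //; first exact: continuous_polyop.
  exact: dense_range_polyop HCx p0.
by move=> y; exact: (polyop_iter p 1).
Qed.

End Hyper.

(** * Distance to the integers *)

Section NearInt.
Variable R : realType.
Implicit Types (t e : R).

Definition near_int e t := exists k : int, `|t - k%:~R| < e.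

Lemma near_intD e1 e2 t1 t2 :
  near_int e1 t1 -> near_int e2 t2 -> near_int (e1 + e2) (t1 + t2).
Proof.
move=> [k1 h1] [k2 h2]; exists (k1 + k2); rewrite intrD opprD addrACA.
by rewrite (le_lt_trans (ler_normD _ _))// ltrD.
Qed.

Lemma near_int_lt e t : `|t| < e -> near_int e t.
Proof. by exists 0; rewrite subr0. Qed.

Lemma near_intMz e t (k : int) :
  0 < e -> near_int (e / (`|k| + 1)%:~R) t -> near_int e (t *~ k).
Proof.
move=> e0 [l h]; exists (l * k).
have k1 : (0 : R) < (`|k| + 1)%:~R by rewrite ltr0z; lia.
rewrite intrM -mulrzr -mulrBl normrM -intr_norm.
move: h; rewrite ltr_pdivlMr//; apply: le_lt_trans.
by rewrite ler_wpM2l// ler_int; lia.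
Qed.

Lemma compact_cluster01 (I : Type) (F : set_system I) (u : I -> R) : ProperFilter F ->
  (forall n, 0 <= u n <= 1) ->
  exists c : R, forall (A : set I) e, F A -> 0 < e -> exists2 n, A n & `|u n - c| < e.
Proof.
move=> FF u01.
have [|c [_ cl]] := @segment_compact R 0 1 (u @ F) _.
  by apply: (@filterS _ F FF setT) => [n _|]; [rewrite /= in_itv/= u01|exact: filterT].
exists c => A e FA e0.
have uA : (u @ F) (u @` A) by apply: (@filterS _ F FF A) => // n An; exists n.
have [_ [[n An <-] h]] := cl _ _ uA (nbhsx_ballx c e e0).
by exists n => //; rewrite distrC.
Qed.

Lemma fracr_le01 t : 0 <= t - (Num.floor t)%:~R <= 1.
Proof.
rewrite subr_ge0 Num.Theory.floor_le lerBlDl.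
by have := ltW (floorD1_gt t); rewrite intrD; apply.
Qed.

Lemma dirichlet t e : 0 < e -> exists n, near_int e (t *+ n.+1).
Proof.
move=> e0; pose u n : R := t *+ n - (Num.floor (t *+ n))%:~R.
have [c cl] := @compact_cluster01 nat \oo u _ (fun n => fracr_le01 _).
have e2 : 0 < e / 2 by rewrite divr_gt0.
have [i _ hi] := cl setT _ filterT e2.
have [j /= ij hj] := cl [set j | (i < j)%N] _ (nbhs_infty_gt i) e2.
exists (j - i).-1; rewrite prednK ?subn_gt0// mulrnBr ?(ltnW ij)//.
exists (Num.floor (t *+ j) - Num.floor (t *+ i)).
have -> : t *+ j - t *+ i - (Num.floor (t *+ j) - Num.floor (t *+ i))%:~R =
    (u j - c) - (u i - c).
  by rewrite intrB /u; ring.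
by rewrite (splitr e) (le_lt_trans (ler_normB _ _))// ltrD.
Qed.

End NearInt.

(** * Limit phases along a recurrence filter *)

Section RecurrenceFilter.
Variables (R : realType) (X : topologicalType) (T : X -> X).

(** The sets of [F] are the times at which finitely many phases are almost
    integers. [rf_shift] says that two such times add up to a third one, provided
    that the second is chosen after the first; [rf_hits] says that these times are
    rich enough for every hypercyclic vector to visit every open set. *)
Record recurrence_filter (F : set_system nat) : Prop := RecurrenceFilter {
  rf_filter : Filter F;
  rf_zero : forall A, F A -> A 0%N;
  rf_shift : forall A, F A -> exists2 B, F B & forall m, B m -> F [set n | A (n + m)%N];
  rf_hits : forall x, HC T x -> forall V, open V -> V !=set0 -> forall A, F A ->
    exists2 n, A n & V (iter n T x) }.

Definition almost_additive (F : set_system nat) (psi : nat -> R) := forall m e, 0 < e ->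
  F [set n | near_int e (psi (n + m)%N - psi n - psi m)].

(** The limits modulo 1 of [psi n] when [T^n x] tends to [y] along [F]: the fibre
    over [y] of the closure of an orbit of the skew product of [T] with [psi].
    Taking it in the reals, and not in the circle, makes it a periodic closed
    set. *)
Definition limit_phases (F : set_system nat) (psi : nat -> R) (x y : X) : set R :=
  [set t | forall V A e, nbhs y V -> F A -> 0 < e ->
    exists n, [/\ A n, V (iter n T x) & near_int e (psi n - t)]].

Section Limset.
Variables (F : set_system nat) (psi : nat -> R).
Hypotheses (gF : recurrence_filter F) (cF : almost_additive F psi) (psi0 : psi 0%N = 0).
Hypothesis cT : forall n, continuous (iter n T).
Local Notation limit_phases := (limit_phases F psi).

Lemma limit_phases_int x y t (k : int) : limit_phases x y t -> limit_phases x y (t + k%:~R).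
Proof.
move=> h V A e yV FA e0; have [n [An Vn nt]] := h V A e yV FA e0.
exists n; split => //; have [l hl] := nt; exists (l - k).
rewrite intrB; suff -> : psi n - (t + k%:~R) - (l%:~R - k%:~R) = psi n - t - l%:~R by [].
by ring.
Qed.

Lemma limit_phases_closed x y t :
  (forall V e, nbhs y V -> 0 < e ->
    exists y' t', [/\ V y', limit_phases x y' t' & `|t' - t| < e]) ->
  limit_phases x y t.
Proof.
move=> h V A e yV FA e0.
have e2 : 0 < e / 2 by rewrite divr_gt0.
have [y' [t' [Vy' h' tt']]] := h _ _ (nbhs_interior yV) e2.
have [n [An Vn nt]] := h' V A _ Vy' FA e2.
exists n; split => //; rewrite -(subrKA t') (splitr e).
by apply: near_intD => //; exact: near_int_lt.
Qed.

(** A time [m] leading from [y] close to [z] is fixed first; then the times [n]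
    leading from [x] close to [y] are composed with it, by continuity of [T^m]
    and because [psi (n + m)] is close to [psi n + psi m] along [F]. *)
Lemma limit_phasesD x y z t s :
  limit_phases x y t -> limit_phases y z s -> limit_phases x z (t + s).
Proof.
move=> ht hs V A e zV FA e0; have [fF _ sF _] := gF.
have [B FB hB] := sF A FA.
have e3 : 0 < e / 3 by rewrite divr_gt0.
have [m [Bm Vm ms]] := hs _ _ _ (nbhs_interior zV) FB e3.
have yV : nbhs y (iter m T @^-1` V) by apply: cT; exact: Vm.
have [n [[An cn] Vn nt]] := ht _ _ _ yV (filterI (hB m Bm) (cF m e3)) e3.
exists (n + m)%N; split => //; first by rewrite addnC iterD.
suff -> : psi (n + m)%N - (t + s) = (psi (n + m)%N - psi n - psi m) + (psi n - t) + (psi m - s).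
  have -> : e = e / 3 + e / 3 + e / 3 by field.
  by do 2?apply: near_intD.
by ring.
Qed.

Lemma limit_phases_refl x : limit_phases x x 0.
Proof.
move=> V A e xV FA e0; exists 0%N; split; first exact: (rf_zero gF).
  exact: nbhs_singleton.
by rewrite psi0 subrr; apply: near_int_lt; rewrite normr0.
Qed.

Lemma limit_phases_commute (L : X -> X) x y t :
  continuous L -> (forall z, L (T z) = T (L z)) ->
  limit_phases x y t -> limit_phases (L x) (L y) t.
Proof.
move=> cL LT h V A e LV FA e0.
have [n [An Vn nt]] := h _ A e (cL y _ LV) FA e0.
exists n; split => //.
suff -> : iter n T (L x) = L (iter n T x) by [].
by elim: n {An Vn nt} => //= n ->.
Qed.

(** The times leading from [x] to [y] generate a proper filter, and the circle is
    compact. *)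
Lemma limit_phases_nonempty x y : HC T x -> limit_phases x y !=set0.
Proof.
move=> HCx; have [fF _ _ rF] := gF.
pose G : set_system nat := [set S | exists V A, [/\ nbhs y V, F A &
  forall n, A n -> V (iter n T x) -> S n]].
have GP : ProperFilter G.
  split.
    move=> [V [A [yV FA h]]]; move: yV; rewrite nbhsE => -[N [oN Ny] NV].
    have [|n An Nn] := rF x HCx N oN _ A FA; first by exists y.
    by apply: (h n) => //; exact: NV.
  split.
  - by exists setT, setT; split => //; exact: filterT.
  - move=> P Q [V [A [yV FA h]]] [V' [A' [yV' FA' h']]].
    exists (V `&` V'), (A `&` A'); split; [exact: filterI|exact: filterI|].
    by move=> n [An A'n] [Vn V'n]; split; [exact: h|exact: h'].
  - move=> P Q PQ [V [A [yV FA h]]]; exists V, A; split => // n An Vn.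
    by apply: PQ; exact: h.
have [c cl] := @compact_cluster01 R nat G (fun n => psi n - (Num.floor (psi n))%:~R) GP
  (fun n => fracr_le01 _).
exists c => V A e yV FA e0.
have GVA : G (A `&` [set n | V (iter n T x)]) by exists V, A; split.
have [n [An Vn] hn] := cl _ _ GVA e0.
by exists n; split => //; exists (Num.floor (psi n)); rewrite addrAC.
Qed.

Lemma limit_phasesMn x t n : limit_phases x x t -> limit_phases x x (t *+ n).
Proof.
move=> h; elim: n => [|n IHn]; first by rewrite mulr0n; exact: limit_phases_refl.
by rewrite mulrS; exact: limit_phasesD h IHn.
Qed.

(** A closed subsemigroup of a compact group is a group: by Dirichlet's theorem
    some positive multiple of [t] is almost an integer, and the preceding multiple
    is then close to [- t] modulo 1. *)
Lemma limit_phasesN x t : limit_phases x x t -> limit_phases x x (- t).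
Proof.
move=> h; apply: limit_phases_closed => V e xV e0.
have [n [k nk]] := dirichlet t e0.
exists x, (t *+ n + (- k)%:~R); split; first exact: nbhs_singleton.
  by apply: limit_phases_int; exact: limit_phasesMn.
by rewrite opprK addrAC -mulrSr intrN.
Qed.

Lemma limit_phasesMz x t (k : int) : limit_phases x x t -> limit_phases x x (t *~ k).
Proof.
move=> h; case: k => n; first exact: limit_phasesMn.
by rewrite NegzE mulrNz; apply: limit_phasesN; exact: limit_phasesMn.
Qed.

(** Hypercyclicity of [y] provides a phase [r] from [y] back to [x]; both [t + r]
    and [t' + r] belong to the group [limit_phases x x]. *)
Lemma limit_phasesB x y t t' : HC T y ->
  limit_phases x y t -> limit_phases x y t' -> limit_phases x x (t - t').
Proof.
move=> HCy h h'; have [r hr] := limit_phases_nonempty x HCy.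
have -> : t - t' = (t + r) + (- (t' + r)) by ring.
by apply: limit_phasesD (limit_phasesD h hr) _; apply: limit_phasesN;
   exact: limit_phasesD h' hr.
Qed.

(** A closed subgroup with arbitrarily small positive elements is the whole line,
    so that any phase from [x] to [y] can be cancelled. *)
Lemma limit_phases_dense x y : HC T x ->
  (forall e, 0 < e -> exists2 t, limit_phases x x t & 0 < t < e) ->
  limit_phases x y 0.
Proof.
move=> HCx h; have [t ht] := limit_phases_nonempty y HCx.
rewrite -(addNr t); apply: limit_phasesD ht; apply: limit_phases_closed => V e xV e0.
have [u hu /andP[u0 ue]] := h e e0.
exists x, (u *~ Num.floor (- t / u)); split; first exact: nbhs_singleton.
  exact: limit_phasesMz.
apply: le_lt_trans ue; rewrite -mulrzr distrC.
have /andP[f0 f1] := fracr_le01 (- t / u).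
have -> : - t - u * (Num.floor (- t / u))%:~R = u * (- t / u - (Num.floor (- t / u))%:~R).
  by field; rewrite gt_eqF.
by rewrite normrM (ger0_norm f0) (gtr0_norm u0) ler_piMr// ltW.
Qed.

(** A relation with closed graph and compact (here: periodic) range is upper
    semicontinuous. *)
Lemma limit_phases_usc x y e : 0 < e ->
  \forall y' \near y, forall t, limit_phases x y' t ->
    exists2 t0, limit_phases x y t0 & `|t - t0| < e.
Proof.
move=> e0.
have ncov := (@compact_near_coveringP R `[0, 1]).1 (@segment_compact R 0 1).
pose P y' t := limit_phases x y' t -> exists2 t0, limit_phases x y t0 & `|t - t0| < e.
have hP (t : R) : `[0, 1]%classic t -> \forall t' \near t & y' \near nbhs y, P y' t'.
  move=> t01; have [ht|ht] := pselect (limit_phases x y t).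
    exists (ball t e, setT); first by split; [exact: nbhsx_ballx|exact: filterT].
    by move=> [t' y'] /= [tt' _] _; exists t; rewrite // distrC.
  have [V [e' [yV e'0 hV]]] : exists V e', [/\ nbhs y V, 0 < e' &
     forall y' t', V y' -> limit_phases x y' t' -> e' <= `|t' - t|].
    apply: contrapT => H; apply: ht; apply: limit_phases_closed => V e' yV e'0.
    apply: contrapT => H'; apply: H; exists V, e'; split => // y' t' Vy' ht'.
    by rewrite leNgt; apply/negP => lt; apply: H'; exists y', t'.
  exists (ball t e', V); first by split; [exact: nbhsx_ballx|].
  move=> [t' y'] /= [tt' Vy'] ht'; have := hV _ _ Vy' ht'.
  by rewrite leNgt distrC tt'.
have := ncov X (nbhs y) P (nbhs_filter y) hP; apply: filterS => y' h t ht.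
have [|| t0 h0 tt0] := h (t - (Num.floor t)%:~R).
- by rewrite /= in_itv; exact: fracr_le01.
- by rewrite -intrN; exact: limit_phases_int.
exists (t0 + (Num.floor t)%:~R); first exact: limit_phases_int.
by rewrite opprD addrA addrAC.
Qed.

(** Uniform continuity on the square of the phase, seen as a map to the quotient
    of the reals by [limit_phases x x]. *)
Lemma limit_phases_unif x (gamma : R * R -> X) e : HC T x -> continuous gamma ->
  let sq := `[0, 1]%classic `*` `[0, 1]%classic in
  (forall z, sq z -> HC T (gamma z)) -> 0 < e ->
  exists2 d : R, 0 < d & forall z z', sq z -> sq z' -> `|z.1 - z'.1| < d -> `|z.2 - z'.2| < d ->
    forall t t', limit_phases x (gamma z) t -> limit_phases x (gamma z') t' ->
    exists2 h, limit_phases x x h & `|t' - t - h| < e.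
Proof.
move=> HCx cg sq HCg e0.
have csq : compact sq by apply: compact_setX; exact: segment_compact.
have ncov := (@compact_near_coveringP _ sq).1 csq.
pose P (d : R) z := sq z -> forall z', sq z' -> `|z.1 - z'.1| < d -> `|z.2 - z'.2| < d ->
    forall t t', limit_phases x (gamma z) t -> limit_phases x (gamma z') t' ->
    exists2 h, limit_phases x x h & `|t' - t - h| < e.
have e2 : 0 < e / 2 by rewrite divr_gt0.
have hP (z : R * R) : sq z -> \forall z' \near z & d \near nbhs (0 : R), P d z'.
  move=> sqz; have := cg z _ (limit_phases_usc x (gamma z) e2).
  case => -[B C] /= [/nbhs_ballP[r1 /= r10 hB] /nbhs_ballP[r2 /= r20 hC]] BC.
  pose r := Num.min r1 r2 / 2.
  have r0 : 0 < r by rewrite divr_gt0// lt_min r10 r20.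
  have rr : r + r <= r1 /\ r + r <= r2.
    by rewrite -splitr !ge_min !lexx orbT.
  exists (ball z.1 r `*` ball z.2 r, ball 0 r).
    split; last exact: nbhsx_ballx.
    by exists (ball z.1 r, ball z.2 r) => //; split; exact: nbhsx_ballx.
  move=> [[a b] d] /= [[za zb] dr] sqa [a' b'] /= sqb aa' bb' t t' ht ht'.
  have dr' : d < r by move: dr; rewrite /ball /= sub0r normrN; exact: le_lt_trans (ler_norm _).
  have near_z (c w w' : R) : `|c - w| < r -> `|w - w'| < d -> `|c - w'| < r + r.
    move=> cw ww'; rewrite -(subrKA w) (le_lt_trans (ler_normD _ _))// ltrD//.
    exact: lt_trans ww' dr'.
  have [t0 ht0 tt0] : exists2 t0, limit_phases x (gamma z) t0 & `|t - t0| < e / 2.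
    apply: (BC (a, b)) => //; split => /=; [apply: hB|apply: hC].
      by apply: lt_le_trans za _; apply: le_trans rr.1; rewrite lerDl ltW.
    by apply: lt_le_trans zb _; apply: le_trans rr.2; rewrite lerDl ltW.
  have [t1 ht1 tt1] : exists2 t0, limit_phases x (gamma z) t0 & `|t' - t0| < e / 2.
    apply: (BC (a', b')) => //; split => /=; [apply: hB|apply: hC].
      by apply: lt_le_trans (near_z _ _ _ za aa') _; exact: rr.1.
    by apply: lt_le_trans (near_z _ _ _ zb bb') _; exact: rr.2.
  exists (t1 - t0); first by apply: limit_phasesB ht1 ht0; exact: HCg.
  have -> : t' - t - (t1 - t0) = (t' - t1) - (t - t0) by ring.
  by rewrite (splitr e) (le_lt_trans (ler_normB _ _))// ltrD.
have := ncov R (nbhs (0 : R)) P (nbhs_filter _) hP.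
move=> /nbhs_ballP[r /= r0 hr].
exists (r / 2); first by rewrite divr_gt0.
move=> z z' sqz sqz'; apply: (hr (r / 2)) => //.
by rewrite /ball /= sub0r normrN gtr0_norm ?divr_gt0// [X in _ < X](splitr r) ltrDl divr_gt0.
Qed.

End Limset.
End RecurrenceFilter.

(** * Discrete lifting from the circle to the line *)

(** [H] is a discrete subgroup of the reals, and a function with values in [R / H]
    is given by arbitrary representatives. Two values that are close modulo [H]
    differ by exactly one small real, their lifted increment; adding the lifted
    increments along a chain of points replaces the lifting of paths. *)
Section Winding.
Variables (R : realType) (H : set R) (eta : R).
Hypotheses (H0 : H 0) (HB : forall a b, H a -> H b -> H (a - b)).
Hypotheses (eta0 : 0 < eta) (Hdisc : forall h, H h -> `|h| < eta -> h = 0).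

Let HD a b : H a -> H b -> H (a + b).
Proof.
move=> ha hb; have hN : H (- b) by rewrite -sub0r; exact: HB.
by rewrite -[b]opprK; exact: HB.
Qed.

(** With increments below [eta / 8], sums of the four increments around a square
    stay below [eta], where 0 is the only element of [H]. *)
Definition is_lift v d := `|d| < eta / 8 /\ H (v - d).
Definition lift v := get [set d | is_lift v d].

Lemma lift_unique v d : is_lift v d -> lift v = d.
Proof.
move=> vd; have [s1 s2] : is_lift v (lift v).
  by apply: (@getPex _ [set d | is_lift v d]); exists d.
apply/eqP; rewrite -subr_eq0; apply/eqP; apply: Hdisc.
  have -> : lift v - d = (v - d) - (v - lift v) by ring.
  by apply: HB => //; case: vd.
rewrite (le_lt_trans (ler_normB _ _))//.
have := ltrD s1 vd.1; move/lt_le_trans; apply; move: (eta) eta0 => e e0; lra.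
Qed.

Lemma lift_spec v d : is_lift v d -> is_lift v (lift v).
Proof. by move=> vd; rewrite (lift_unique vd). Qed.

Lemma lift_congr v v' : H (v - v') -> lift v = lift v'.
Proof.
move=> vv'; congr get; apply/seteqP; split => d [s1 s2]; split => //.
  have -> : v' - d = (v - d) - (v - v') by ring.
  exact: HB.
have -> : v - d = (v' - d) + (v - v') by ring.
exact: HD.
Qed.

Definition winding (u : nat -> R) n := \sum_(0 <= i < n) lift (u i.+1 - u i).

Lemma windingS u n : winding u n.+1 = winding u n + lift (u n.+1 - u n).
Proof. by rewrite /winding big_nat_recr. Qed.

Lemma winding_mod u n : (forall i, (i < n)%N -> exists d, is_lift (u i.+1 - u i) d) ->
  H (u n - u 0%N - winding u n).
Proof.
elim: n => [|n IHn] hu; first by rewrite /winding big_nil subrr subr0.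
have [d /lift_spec [_ hd]] := hu n (ltnSn n).
rewrite windingS; have -> : u n.+1 - u 0%N - (winding u n + lift (u n.+1 - u n)) =
  (u n - u 0%N - winding u n) + (u n.+1 - u n - lift (u n.+1 - u n)) by ring.
by apply: HD => //; apply: IHn => i ni; apply: hu; exact: ltnW.
Qed.

(** Points that stay close to [H] have an obvious lift, their signed distance to [H],
    whose increments telescope. *)
Lemma winding_small u n e : 0 < e -> e <= eta / 16 ->
  (forall i, (i <= n)%N -> exists2 h, H h & `|u i - h| < e) -> `|winding u n| < 2 * e.
Proof.
move=> e0 ee hu.
have [f hf] : exists f : nat -> R, forall i, (i <= n)%N -> H (f i) /\ `|u i - f i| < e.
  have /choice [f hf] : forall i, exists h, (i <= n)%N -> H h /\ `|u i - h| < e.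
    move=> i; case: (leqP i n) => [|_]; last by exists 0.
    by move=> /hu [h h1 h2]; exists h.
  by exists f.
suff -> : winding u n = (u n - f n) - (u 0%N - f 0%N).
  rewrite (le_lt_trans (ler_normB _ _))// mulr_natl mulr2n.
  by apply: ltrD; [exact: (hf n _).2|exact: (hf 0%N _).2].
rewrite /winding -(telescope_sumr (fun i => u i - f i))//.
apply: eq_big_nat => i /andP[_ ni]; apply: lift_unique.
have [h1 h2] := hf i (ltnW ni); have [h3 h4] := hf i.+1 ni.
split; last first.
  have -> : u i.+1 - u i - (u i.+1 - f i.+1 - (u i - f i)) = f i.+1 - f i by ring.
  exact: HB.
rewrite (le_lt_trans (ler_normB _ _))// (lt_le_trans (ltrD h4 h2))//; lra.
Qed.

(** Around a small square the total lifted increment is small and belongs to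
    [H], hence vanishes. *)
Lemma lift_square a b c d : (exists e, is_lift (b - a) e) -> (exists e, is_lift (d - b) e) ->
  (exists e, is_lift (c - a) e) -> (exists e, is_lift (d - c) e) ->
  lift (b - a) + lift (d - b) = lift (c - a) + lift (d - c).
Proof.
move=> [? /lift_spec[h1 H1]] [? /lift_spec[h2 H2]].
move=> [? /lift_spec[h3 H3]] [? /lift_spec[h4 H4]].
apply/eqP; rewrite -subr_eq0; apply/eqP; apply: Hdisc.
  set x := lift (b - a) in H1 *; set y := lift (d - b) in H2 *.
  set z := lift (c - a) in H3 *; set w := lift (d - c) in H4 *.
  have -> : x + y - (z + w) = (c - a - z) + (d - c - w) - (b - a - x) - (d - b - y) by ring.
  by do 2?apply: HB => //; exact: HD.
move: h1 h2 h3 h4; rewrite !ltr_norml => /andP[? ?] /andP[? ?] /andP[? ?] /andP[? ?].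
apply/andP; split; lra.
Qed.

(** Homotopy invariance: the small squares of a grid cancel, so that the two ways
    around its boundary have the same winding. *)
Lemma winding_grid (u : nat -> nat -> R) n m :
  (forall i j, (i < n)%N -> (j <= m)%N -> exists d, is_lift (u i.+1 j - u i j) d) ->
  (forall i j, (i <= n)%N -> (j < m)%N -> exists d, is_lift (u i j.+1 - u i j) d) ->
  winding (u^~ 0%N) n + winding (u n) m = winding (u 0%N) m + winding (u^~ m) n.
Proof.
elim: m => [|m IHm] hh hv.
  by rewrite [winding (u n) 0]/winding [winding (u 0%N) 0]/winding !big_nil addr0 add0r.
rewrite !windingS addrA IHm; last 2 first.
- by move=> i j ni nj; apply: hh => //; exact: leqW.
- by move=> i j ni nj; apply: hv => //; exact: leqW.
rewrite -!addrA; congr (_ + _).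
elim: n hh hv {IHm} => [|n IHn] hh hv; first by rewrite /winding !big_nil addr0 add0r.
rewrite !windingS -addrA [RHS]addrA -IHn; last 2 first.
- by move=> i j ni nj; apply: hh => //; exact: leqW.
- by move=> i j ni nj; apply: hv => //; exact: leqW.
rewrite -addrA; congr (_ + _).
apply: lift_square; [exact: hh|exact: hv|exact: hv|exact: hh].
Qed.

End Winding.

(** * Adding a phase to a recurrence filter *)

Section Core.
Variables (R : realType) (K : numClosedFieldType) (X : topologicalLmodType K).
Variables (iota : {rmorphism R -> K}).
Hypothesis iota_continuous : continuous (iota : R -> K^o).
Hypothesis iota_le1 : forall s, 0 <= s <= 1 -> `|iota s| <= 1.
Variables (T : {linear X -> X}) (T_continuous : continuous T).
Variables (F : set_system nat) (psi : nat -> R).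
Hypotheses (gF : recurrence_filter T F) (cF : almost_additive F psi) (psi0 : psi 0%N = 0).
Local Notation L := (limit_phases T F psi).

Let cT n : continuous (iter n T). Proof. exact: continuous_iter. Qed.

Definition seg (y z : X) (s : R) : X := iota (1 - s) *: y + iota s *: z.
(** The homotopy whose rows go from the segment [x, T^k x] to the segment
    [x, T^(k+1) x]: it sweeps the triangle on [x], [T^k x] and [T^(k+1) x]. *)
Definition sweep x k (z : R * R) := seg x (seg (iter k T x) (iter k.+1 T x) z.2) z.1.

Lemma seg0 y z : seg y z 0 = y.
Proof. by rewrite /seg subr0 rmorph1 rmorph0 scale1r scale0r addr0. Qed.

Lemma seg1 y z : seg y z 1 = z.
Proof. by rewrite /seg subrr rmorph1 rmorph0 scale1r scale0r add0r. Qed.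

Lemma iter_seg n y z s : iter n T (seg y z s) = seg (iter n T y) (iter n T z) s.
Proof. by elim: n => //= n ->; rewrite /seg linearD !linearZ_LR. Qed.

Lemma continuous_sweep x k : continuous (sweep x k).
Proof.
have c1 : continuous (fun z : R * R => (iota z.1 : K^o)).
  by move=> z; apply: (continuous_comp cvg_fst); exact: iota_continuous.
have c2 : continuous (fun z : R * R => (iota z.2 : K^o)).
  by move=> z; apply: (continuous_comp cvg_snd); exact: iota_continuous.
have c1' : continuous (fun z : R * R => (iota (1 - z.1) : K^o)).
  move=> z; apply: (@continuous_comp _ _ _ (fun z : R * R => 1 - z.1) (iota : R -> K^o)).
    by apply: continuousB; [exact: cvg_cst|exact: cvg_fst].
  exact: iota_continuous.
have c2' : continuous (fun z : R * R => (iota (1 - z.2) : K^o)).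
  move=> z; apply: (@continuous_comp _ _ _ (fun z : R * R => 1 - z.2) (iota : R -> K^o)).
    by apply: continuousB; [exact: cvg_cst|exact: cvg_snd].
  exact: iota_continuous.
rewrite /sweep /seg; apply: continuous_add; apply: continuous_scale => //.
  exact: continuous_cst.
by apply: continuous_add; apply: continuous_scale => //; exact: continuous_cst.
Qed.

(** Points of the triangle are [p(T) x], and [p] is nonzero because 1, [X^k] and
    [X^(k+1)] are linearly independent when [k > 0]. *)
Lemma HC_sweep x k z : HC T x -> (0 < k)%N -> HC T (sweep x k z).
Proof.
move=> HCx k0; pose p : {poly K} := iota (1 - z.1) *: 'X^0 +
  iota z.1 *: (iota (1 - z.2) *: 'X^k + iota z.2 *: 'X^(k.+1)).
have -> : sweep x k z = polyop T p x.
  by rewrite /p !(polyopD, polyopZ, polyop_Xn).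
apply: HC_polyop => //; apply/negP => /eqP p0.
have coefp i : p`_i = 0 by rewrite p0 coef0.
have := coefp 0%N.
rewrite /p !(coefD, coefZ, coefXn) /= eq_sym (gtn_eqF k0) !(mulr0, addr0, mulr1).
move/eqP; rewrite fmorph_eq0 => /eqP z1.
have z11 : z.1 = 1 by lra.
have := coefp k; rewrite /p !(coefD, coefZ, coefXn) z11 subrr rmorph0 mul0r add0r eqxx.
rewrite (ltn_eqF (ltnSn k)) mulr0 addr0 mulr1 rmorph1 mul1r => /eqP.
rewrite fmorph_eq0 => /eqP z2.
have := coefp k.+1; rewrite /p !(coefD, coefZ, coefXn) z11 subrr rmorph0 mul0r add0r eqxx.
rewrite (gtn_eqF (ltnSn k)) mulr0 add0r mulr1 rmorph1 mul1r => /eqP.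
by rewrite fmorph_eq0; move/eqP; lra.
Qed.

Lemma sweep10 x k s : sweep x k (s, 0) = seg x (iter k T x) s.
Proof. by rewrite /sweep seg0. Qed.

Lemma sweep11 x k s : sweep x k (s, 1) = seg x (iter k.+1 T x) s.
Proof. by rewrite /sweep seg1. Qed.

Lemma HC_iter x n : HC T x -> HC T (iter n T x).
Proof.
by move=> HCx; rewrite -polyop_Xn; apply: HC_polyop; rewrite // monic_neq0 ?monicXn.
Qed.

(** A return of the orbit close to [x] brings the whole segment from [x] to
    [T^(n+1) x] into a neighbourhood of [x] on which the phase is almost constant.
    The vector [T x] is used to get a return time that is not 0. *)
Lemma limit_phases_return x e : HC T x -> 0 < e -> exists n, forall s t,
  0 <= s <= 1 -> L x (seg x (iter n.+1 T x) s) t -> exists2 h, L x x h & `|t - h| < e.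
Proof.
move=> HCx e0; have usc := limit_phases_usc T F psi x x e0.
have [W W0 WB] : exists2 W : set X, nbhs 0 W & forall b w, `|b| <= 1 -> W w ->
    forall t, L x (b *: w + x) t -> exists2 h, L x x h & `|t - h| < e.
  have /nbhs0_balanced [W W0 WB] : nbhs (0 : X) [set u | forall t, L x (u + x) t ->
      exists2 h, L x x h & `|t - h| < e].
    by apply: (@nbhs_addr X x 0 (fun u => forall t, L x u t -> _)); rewrite add0r.
  by exists W.
have : nbhs x [set u | W (u - x)] by apply: nbhs_addr; rewrite subrr.
rewrite nbhsE => -[N [oN Nx] NW].
have [|z [Nz [n _ nE]]] := HC_iter 1 HCx _ oN; first by exists x.
exists n => s t s01.
have -> : seg x (iter n.+1 T x) s = iota s *: (iter n.+1 T x - x) + x.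
  by rewrite /seg rmorphB rmorph1 scalerBl scale1r scalerBr addrC addrA addrAC.
apply: WB; first exact: iota_le1.
by apply: NW; rewrite iterSr nE.
Qed.

(** With [l k] the winding of the phase along the segment from [x] to [T^k x], the
    triangles give [l k.+1 = l k + l 1]; so [l n.+1 = (n + 1) l 1], which is small
    when [T^(n+1) x] returns close to [x]. As [l 1] is the phase from [x] to
    [T x] up to [H = limit_phases x x], that phase belongs to the closed group
    [H]. *)
Lemma limit_phases_step x : HC T x -> L x (T x) 0.
Proof.
move=> HCx.
have [full|/existsNP [eta /not_implyP [eta0 Heta]]] :=
    pselect (forall e, 0 < e -> exists2 t, L x x t & 0 < t < e).
  exact: (@limit_phases_dense R X T F psi gF cF psi0 cT x (T x) HCx full).
pose H := L x x.
have H0 : H 0 by exact: limit_phases_refl.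
have HB a b : H a -> H b -> H (a - b) by move=> ha hb; exact: limit_phasesB HCx ha hb.
have Hdisc h : H h -> `|h| < eta -> h = 0.
  move=> Hh hlt; apply: contrapT => /eqP hn0; apply: Heta.
  have [h0|h0] := ltP 0 h; first by exists h => //; rewrite h0 (le_lt_trans (ler_norm _) hlt).
  exists (- h); first by rewrite -sub0r; exact: HB.
  rewrite oppr_gt0 lt_neqAle hn0 h0 /=; apply: le_lt_trans hlt.
  by rewrite -normrN ler_norm.
have /choice[phi hphi] : forall y, exists t, L x y t.
  by move=> y; have [t ht] := limit_phases_nonempty psi gF y HCx; exists t.
suff HT : H (phi (T x)).
  rewrite -(addNr (phi (T x))); apply: (@limit_phasesD R X T F psi gF cF cT x x (T x)) => //.
  exact: (@limit_phasesN R X T F psi).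
apply: (@limit_phases_closed R X T F psi) => V e xV e0.
(* [eta / 16] is required by [winding_small]; [e / 4] makes [2 * e1 < e]. *)
pose e1 := Num.min (e / 4) (eta / 16).
have e10 : 0 < e1 by rewrite lt_min !divr_gt0.
have [n ret] := limit_phases_return HCx e10.
(* The mesh must serve all the triangles up to the return time. *)
have [d d0 hd] : exists2 d, 0 < d & forall k, (0 < k <= n.+1)%N ->
    forall z z' : R * R, (`[0, 1]%classic `*` `[0, 1]%classic) z ->
    (`[0, 1]%classic `*` `[0, 1]%classic) z' ->
    `|z.1 - z'.1| < d -> `|z.2 - z'.2| < d ->
    exists e, is_lift H eta (phi (sweep x k z') - phi (sweep x k z)) e.
  elim: n.+1 => [|m [d d0 IHm]].
    by exists 1 => // k; rewrite leqn0 => /andP[+ /eqP k0]; rewrite k0.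
  have [||d' d'0 hd'] := limit_phases_unif gF cF psi0 cT HCx
    (@continuous_sweep x m.+1) _ (_ : 0 < eta / 8).
  - by move=> z _; exact: HC_sweep.
  - by rewrite divr_gt0.
  exists (Num.min d d'); first by rewrite lt_min d0.
  move=> k /andP[k0 km] z z' sz sz'; rewrite !lt_min => /andP[h1 h1'] /andP[h2 h2'].
  move: km; rewrite leq_eqVlt ltnS => /orP[/eqP ->|km]; last by apply: IHm => //; rewrite k0.
  have [h Hh hlt] := hd' z z' sz sz' h1' h2' _ _ (hphi _) (hphi _).
  exists (phi (sweep x m.+1 z') - phi (sweep x m.+1 z) - h); split => //.
  by rewrite subKr.
have [N N0 Nd] : exists2 N : nat, (0 < N)%N & N%:R^-1 < d.
  have := nbhs_infty_gtr d^-1 => -[N _ hN]; exists N.+1 => //.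
  by rewrite invf_plt ?posrE//; apply: hN => /=.
have N0' : (0 : R) < N%:R by rewrite ltr0n.
pose pt i : R := i%:R / N%:R.
have pt01 i : (i <= N)%N -> `[0, 1]%classic (pt i).
  by move=> iN; rewrite /= in_itv /= divr_ge0//= ler_pdivrMr// mul1r ler_nat.
have ptS i : `|pt i - pt i.+1| < d.
  by rewrite /pt -mulrBl -opprB -natrB// subSnn mulN1r normrN gtr0_norm// invr_gt0.
have pt0 : pt 0%N = 0 by rewrite /pt mul0r.
have ptN : pt N = 1 by rewrite /pt divff// gt_eqF.
have dd i : `|pt i - pt i| < d by rewrite subrr normr0.
pose u k i j := phi (sweep x k (pt i, pt j)).
pose l k := winding H eta (fun i => phi (seg x (iter k T x) (pt i))) N.
have lS k : (0 < k <= n)%N -> l k.+1 = l k + l 1%N.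
  move=> /andP[k0 kn].
  have kn1 : (0 < k <= n.+1)%N by rewrite k0 leqW.
  have hh i j : (i < N)%N -> (j <= N)%N -> exists d, is_lift H eta (u k i.+1 j - u k i j) d.
    by move=> iN jN; apply: hd => //=; split => /=; apply: pt01 => //; exact: ltnW.
  have hv i j : (i <= N)%N -> (j < N)%N -> exists d, is_lift H eta (u k i j.+1 - u k i j) d.
    by move=> iN jN; apply: hd => //=; split => /=; apply: pt01 => //; exact: ltnW.
  have := winding_grid H0 HB eta0 Hdisc hh hv.
  have -> : winding H eta ((u k)^~ 0%N) N = l k.
    by congr winding; apply/funext => i; rewrite /u pt0 sweep10.
  have -> : winding H eta ((u k)^~ N) N = l k.+1.
    by congr winding; apply/funext => i; rewrite /u ptN sweep11.
  have -> : winding H eta (u k 0%N) N = 0.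
    rewrite /winding big1// => j _; rewrite /u pt0 /sweep !seg0 subrr.
    by apply: (lift_unique HB eta0 Hdisc); split; rewrite ?normr0 ?divr_gt0// subr0.
  suff -> : winding H eta (u k N) N = l 1%N by rewrite add0r.
  apply: eq_big_nat => j /andP[_ jN]; apply: (lift_congr eta H0 HB).
  (* [T^k] carries the segment from [x] to [T x] onto the last side of the
     triangle and shifts all its phases by the same constant modulo [H]. *)
  have shift y : HC T y -> H (phi (iter k T y) - (phi (iter k T x) + phi y)).
    move=> HCy; apply: (@limit_phasesB R X T F psi gF cF psi0 cT x (iter k T y)) => //.
      exact: HC_iter.
    apply: (@limit_phasesD R X T F psi gF cF cT x (iter k T x)) => //.
    by apply: (@limit_phases_commute R X T F psi) => // z; rewrite -iterS iterSr.
  have sk i : sweep x k (1, pt i) = iter k T (seg x (iter 1 T x) (pt i)).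
    by rewrite /sweep seg1 iter_seg -iterD addn1.
  have HCs i : HC T (seg x (iter 1 T x) (pt i)).
    by rewrite -sweep10; exact: HC_sweep.
  rewrite /u ptN !sk; set q := seg _ _ (pt j); set q' := seg _ _ (pt j.+1).
  have -> : phi (iter k T q') - phi (iter k T q) - (phi q' - phi q) =
    (phi (iter k T q') - (phi (iter k T x) + phi q')) -
    (phi (iter k T q) - (phi (iter k T x) + phi q)) by ring.
  by apply: HB; apply: shift; exact: HCs.
have lM m : (m <= n)%N -> l m.+1 = l 1%N *+ m.+1.
  elim: m => [|m IHm] mn; first by rewrite mulr1n.
  by rewrite lS// IHm ?mulrSr// ltnW.
have ln : `|l n.+1| < 2 * e1.
  apply: (winding_small HB eta0 Hdisc) => //; first by rewrite ge_min lexx orbT.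
  by move=> i iN; apply: (ret (pt i)) => //; have := pt01 i iN; rewrite /= in_itv.
have l1 : `|l 1%N| < 2 * e1.
  apply: le_lt_trans ln; rewrite (lM n)// normrMn; by rewrite mulrS lerDl mulrn_wge0.
have lmod : H (phi (T x) - phi x - l 1%N).
  have := @winding_mod R H eta H0 HB eta0 Hdisc (fun i => phi (seg x (iter 1 T x) (pt i))) N.
  rewrite ptN pt0 seg1 seg0; apply => i iN.
  have sq0 : `[0, 1]%classic (0 : R) by rewrite /= in_itv /= lexx ler01.
  rewrite -!sweep10; apply: hd => //=; last by rewrite subrr normr0.
    by split => //; exact: pt01 (ltnW iN).
  by split => //; exact: pt01.
exists x, (phi (T x) - l 1%N); split; first exact: nbhs_singleton.
  have -> : phi (T x) - l 1%N = (phi (T x) - phi x - l 1%N) - (0 - phi x) by ring.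
  by apply: (HB _ _ lmod); apply: (HB _ _ H0); exact: hphi.
have -> : phi (T x) - l 1%N - phi (T x) = - l 1%N by ring.
have e14 : e1 <= e / 4 by rewrite ge_min lexx.
by rewrite normrN (lt_le_trans l1)//; lra.
Qed.

(** The phase 0 is attained along the whole orbit of [x], which is dense, and the
    graph of the limit phases is closed. *)
Lemma limit_phases0 x y : HC T x -> L x y 0.
Proof.
move=> HCx.
have orb n : L x (iter n T x) 0.
  elim: n => [|n IHn]; first exact: (@limit_phases_refl R X T F psi).
  rewrite -(addr0 0); apply: (@limit_phasesD R X T F psi gF cF cT x (iter n T x)) => //.
  by apply: limit_phases_step; exact: HC_iter.
apply: (@limit_phases_closed R X T F psi) => V e; rewrite nbhsE => -[N [oN Ny] NV] e0.
have [|z [Nz [n _ nE]]] := HCx N _ oN; first by exists y.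
by exists z, 0; rewrite subrr normr0 -nE; split => //; apply: NV; rewrite nE.
Qed.

Lemma recurrence_filter_extend : exists2 F', recurrence_filter T F' &
  F `<=` F' /\ forall e, 0 < e -> F' [set n | near_int e (psi n)].
Proof.
have [fF F0 sF rF] := gF.
pose F' : set_system nat := [set S | exists2 A, F A & exists2 e : R, 0 < e &
   forall n, A n -> near_int e (psi n) -> S n].
exists F'; last first.
  split; first by move=> A FA; exists A => //; exists 1.
  by move=> e e0; exists setT; [exact: filterT|exists e].
split.
- split.
  + by exists setT; [exact: filterT|exists 1].
  + move=> P Q [A FA [e e0 h]] [B FB [d d0 k]].
    exists (A `&` B); first exact: filterI.
    exists (Num.min e d); first by rewrite lt_min e0.
    move=> n [An Bn] [m]; rewrite lt_min => /andP[h1 h2].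
    by split; [apply: h => //; exists m|apply: k => //; exists m].
  + move=> P Q PQ [A FA [e e0 h]]; exists A => //; exists e => // n An en.
    by apply: PQ; exact: h.
- move=> S [A FA [e e0 h]]; apply: h; first exact: F0.
  by rewrite psi0; apply: near_int_lt; rewrite normr0.
- move=> S [A FA [e e0 h]]; have [B FB hB] := sF A FA.
  have e3 : 0 < e / 3 by rewrite divr_gt0.
  exists [set n | B n /\ near_int (e / 3) (psi n)].
    by exists B => //; exists (e / 3).
  move=> m [Bm psim]; exists ([set n | A (n + m)%N] `&` [set n |
      near_int (e / 3) (psi (n + m)%N - psi n - psi m)]).
    by apply: filterI; [exact: hB|exact: cF].
  exists (e / 3) => // n [An cn] psin; apply: h => //.
  have -> : psi (n + m)%N = (psi (n + m)%N - psi n - psi m) + psi n + psi m by ring.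
  have -> : e = e / 3 + e / 3 + e / 3 by field.
  by do 2?apply: near_intD.
- move=> x HCx V oV [y Vy] S [A FA [e e0 h]].
  have [n [An Vn psin]] := @limit_phases0 x y HCx _ _ _ (open_nbhs_nbhs (conj oV Vy)) FA e0.
  by exists n => //; apply: h => //; rewrite -[psi n]subr0.
Qed.

End Core.

(** * Bogolyubov's theorem for sets of integers with bounded gaps *)

Lemma cos_int_periodic (R : realType) (x : R) (k : int) : cos (x + pi *+ 2 * k%:~R) = cos x.
Proof.
case: k => n; first by rewrite -[n%:~R]/(n%:R) mulr_natr (periodicn (@cosD2pi R)).
rewrite NegzE intrN mulrN -[LHS](periodicn (@cosD2pi R) n.+1).
by rewrite -[pi *+ 2 *+ _]mulr_natr subrK.
Qed.

Lemma cos_near_int (R : realType) (t : R) : near_int (1 / 4) t -> 0 < cos (pi *+ 2 * t).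
Proof.
move=> [k tk]; rewrite -(cos_int_periodic _ (- k)) intrN -mulrDr.
have p0 := pi_gt0 R.
move: tk; rewrite ltr_norml => /andP[h1 h2]; apply: cos_gt0_pihalf.
by apply/andP; split; nra.
Qed.

Lemma sum_cos_sin (R : realType) (h : R) m :
  (\sum_(0 <= r < m) cos (h * r%:R *+ 2)) * (sin h *+ 2) = sin (h * m%:R *+ 2 - h) + sin h.
Proof.
elim: m => [|m IHm]; first by rewrite big_nil mul0r mulr0 mul0rn sub0r sinN addNr.
rewrite big_nat_recr//= mulrDl IHm.
have -> : h * m.+1%:R *+ 2 - h = h * m%:R *+ 2 + h by rewrite -natr1; ring.
by move: (h * m%:R *+ 2) => A; rewrite sinB sinD; ring.
Qed.

Lemma sum_cos_eq0 (R : realType) (M : nat) (k : int) : k != 0 -> (`|k| < M)%N ->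
  \sum_(0 <= r < M) cos (pi *+ 2 / M%:R * r%:R * k%:~R) = 0 :> R.
Proof.
move=> k0 kM; have M0 : (0 : R) < M%:R by rewrite ltr0n; lia.
pose h : R := pi * `|k|%N%:R / M%:R.
have hpi : 0 < h < pi.
  have k0' : (0 : R) < `|k|%N%:R by rewrite ltr0n absz_gt0.
  apply/andP; split; first by rewrite divr_gt0// mulr_gt0// pi_gt0.
  by rewrite ltr_pdivrMr// ltr_pM2l ?pi_gt0// ltr_nat.
have sh : sin h *+ 2 != 0.
  by have sh0 := sin_gt0_pi hpi; rewrite mulrn_eq0 /= gt_eqF.
have -> : \sum_(0 <= r < M) cos (pi *+ 2 / M%:R * r%:R * k%:~R) =
          \sum_(0 <= r < M) cos (h * r%:R *+ 2) :> R.
  have ck (x : R) : cos (x * k%:~R) = cos (x * `|k|%N%:R).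
    by case: (k) => m //; rewrite NegzE abszN intrN mulrN cosN.
  apply: eq_bigr => r _; rewrite ck; congr cos; rewrite /h; ring.
apply: (mulIf sh); rewrite sum_cos_sin mul0r.
have -> : h * M%:R *+ 2 - h = - h + pi *+ 2 *+ `|k|%N.
  have -> : h * M%:R = pi * `|k|%N%:R by rewrite /h mulfVK ?gt_eqF.
  by rewrite -[pi *+ 2 *+ _]mulr_natr; ring.
by rewrite (periodicn (@sinD2pi R)) sinN addNr.
Qed.

(** Fourier analysis in the integers modulo [M], for the set [A] of the points
    [a i] with [i < q], one in each block of length [B]; its density is
    [1 / (4 B)]. All the points are below [M / 4], so that a relation modulo [M]
    between sums and differences of four points and a number [n] bounded by
    [M / 2] is a relation between integers. Cosines are enough, because only
    the squared moduli of the Fourier coefficients occur. *)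
Section Bogolyubov.
Variables (R : realType) (q B : nat) (a : nat -> nat).
Hypotheses (q0 : (0 < q)%N) (B0 : (0 < B)%N).
Hypothesis a_block : forall i, (i * B <= a i < i.+1 * B)%N.

Let M := (4 * q * B)%N.
Let w : R := pi *+ 2 / M%:R.
Let wave r (v : int) : R := cos (w * r%:R * v%:~R).
(* The squared modulus of the Fourier coefficient of [A] at the frequency [r]. *)
Let energy r : R := \sum_(i < q) \sum_(j < q) wave r ((a i)%:Z - (a j)%:Z).

Let M0 : (0 < M)%N. Proof. by rewrite !muln_gt0 q0 B0. Qed.

Lemma block_lt i : (i < q)%N -> (a i < q * B)%N.
Proof.
by move=> iq; have /andP[_ h] := a_block i; apply: leq_trans h _; rewrite leq_mul2r iq orbT.
Qed.

Lemma block_inj i j : a i = a j -> i = j.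
Proof.
have le i' j' : a i' = a j' -> (i' <= j')%N.
  have /andP[h1 _] := a_block i'; have /andP[_ h2] := a_block j' => aij.
  by rewrite -ltnS -(ltn_pmul2r B0); apply: leq_ltn_trans h1 _; rewrite aij.
by move=> aij; apply/eqP; rewrite eqn_leq !le.
Qed.

Lemma energy_ge0 r : 0 <= energy r.
Proof.
suff -> : energy r = (\sum_(i < q) cos (w * r%:R * (a i)%:R)) ^+ 2 +
              (\sum_(i < q) sin (w * r%:R * (a i)%:R)) ^+ 2.
  by rewrite addr_ge0 ?sqr_ge0.
rewrite !expr2 !big_distrlr -big_split; apply: eq_bigr => i _.
rewrite -big_split; apply: eq_bigr => j _ /=.
by rewrite /wave intrB mulrBr cosB.
Qed.

Lemma energy0 : energy 0%N = q%:R ^+ 2.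
Proof.
rewrite /energy (eq_bigr (fun=> q%:R)) => [|i _].
  by rewrite sumr_const card_ord expr2 mulr_natr.
rewrite (eq_bigr (fun=> 1)) ?sumr_const ?card_ord// => j _.
by rewrite /wave mulr0 mul0r cos0.
Qed.

(** Parseval's identity. *)
Lemma sum_energy : \sum_(0 <= r < M) energy r = M%:R * q%:R.
Proof.
rewrite /energy exchange_big /= (eq_bigr (fun=> M%:R)) => [|i _].
  by rewrite sumr_const card_ord mulr_natr.
rewrite exchange_big /= (bigD1 i)//= [X in _ + X]big1 ?addr0 => [|j ji].
  rewrite (eq_bigr (fun=> 1)) ?sumr_const_nat ?subn0// => r _.
  by rewrite /wave subrr mulr0 cos0.
apply: sum_cos_eq0.
  rewrite subr_eq0; apply: contra ji => /eqP [aij]; apply/eqP/val_inj => /=.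
  by symmetry; exact: block_inj.
have := block_lt (ltn_ord i); have := block_lt (ltn_ord j); rewrite /M; lia.
Qed.

Lemma cos3 (x y z : R) : cos x * cos y * cos z =
  (cos (z + x + y) + cos (z + x - y) + cos (z - x + y) + cos (z - x - y)) / 4.
Proof. by rewrite !(cosD, sinD, cosN, sinN); field. Qed.

(** The sum counts, up to the factor [M], the representations of [n] by sums and
    differences of four points of [A]. *)
Lemma sum_energy2_eq0 (n : int) : (`|n| < 2 * q * B)%N ->
  (forall i j k l, (i < q)%N -> (j < q)%N -> (k < q)%N -> (l < q)%N ->
     n <> (a i)%:Z + (a j)%:Z - (a k)%:Z - (a l)%:Z) ->
  \sum_(0 <= r < M) energy r ^+ 2 * wave r n = 0.
Proof.
move=> nq hn.
have -> : \sum_(0 <= r < M) energy r ^+ 2 * wave r n =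
    \sum_(0 <= r < M) \sum_(i < q) \sum_(j < q) \sum_(k < q) \sum_(l < q)
      wave r ((a i)%:Z - (a j)%:Z) * wave r ((a k)%:Z - (a l)%:Z) * wave r n.
  apply: eq_bigr => r _; rewrite expr2 {1}/energy mulr_suml big_distrl; apply: eq_bigr => i _.
  rewrite mulr_suml big_distrl; apply: eq_bigr => j _.
  rewrite mulr_sumr big_distrl; apply: eq_bigr => k _.
  by rewrite mulr_sumr big_distrl.
rewrite exchange_big big1// => i _ /=; rewrite exchange_big big1// => j _ /=.
rewrite exchange_big big1// => k _ /=; rewrite exchange_big big1// => l _ /=.
have Ai := block_lt (ltn_ord i); have Aj := block_lt (ltn_ord j).
have Ak := block_lt (ltn_ord k); have Al := block_lt (ltn_ord l).
have z0 (v : int) : v != 0 -> (`|v| < M)%N -> \sum_(0 <= r < M) wave r v = 0.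
  exact: sum_cos_eq0.
pose v1 : int := n + ((a i)%:Z - (a j)%:Z) + ((a k)%:Z - (a l)%:Z).
pose v2 : int := n + ((a i)%:Z - (a j)%:Z) - ((a k)%:Z - (a l)%:Z).
pose v3 : int := n - ((a i)%:Z - (a j)%:Z) + ((a k)%:Z - (a l)%:Z).
pose v4 : int := n - ((a i)%:Z - (a j)%:Z) - ((a k)%:Z - (a l)%:Z).
have cE r : wave r ((a i)%:Z - (a j)%:Z) * wave r ((a k)%:Z - (a l)%:Z) * wave r n =
    (wave r v1 + wave r v2 + wave r v3 + wave r v4) / 4.
  rewrite /wave cos3; congr ((cos _ + cos _ + cos _ + cos _) / 4);
    by rewrite /v1 /v2 /v3 /v4 !(intrD, intrN); ring.
rewrite (eq_bigr _ (fun r _ => cE r)).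
rewrite -mulr_suml !big_split /=.
have n1 := hn j l i k (ltn_ord _) (ltn_ord _) (ltn_ord _) (ltn_ord _).
have n2 := hn j k i l (ltn_ord _) (ltn_ord _) (ltn_ord _) (ltn_ord _).
have n3 := hn i l j k (ltn_ord _) (ltn_ord _) (ltn_ord _) (ltn_ord _).
have n4 := hn i k j l (ltn_ord _) (ltn_ord _) (ltn_ord _) (ltn_ord _).
rewrite (z0 v1) ?(z0 v2) ?(z0 v3) ?(z0 v4) ?addr0 ?mul0r// /v1 /v2 /v3 /v4 /M; lia.
Qed.

Let threshold : R := q%:R ^+ 2 / (8 * B%:R).
Let spectrum := [seq r <- iota 0 M | threshold <= energy r].

(** Markov's inequality for the energies, whose sum is known. The bound does not
    depend on [q], which makes a limit possible when [q] tends to infinity. *)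
Lemma size_spectrum : (size spectrum <= 32 * B ^ 2)%N.
Proof.
have q0' : (0 : R) < q%:R by rewrite ltr0n.
have B0' : (0 : R) < B%:R by rewrite ltr0n.
have t0 : 0 < threshold by rewrite divr_gt0 ?exprn_gt0// mulr_gt0.
rewrite -(ler_nat R) -(ler_pM2r t0).
have -> : (32 * B ^ 2)%:R * threshold = M%:R * q%:R.
  by rewrite /threshold /M -mulnn !natrM; field; rewrite gt_eqF.
rewrite -sum_energy (bigID (fun r => threshold <= energy r)) /= -big_filter -/spectrum.
rewrite -[leLHS]addr0 lerD//; last by rewrite sumr_ge0// => r _; exact: energy_ge0.
have -> : [seq r <- index_iota 0 M | threshold <= energy r] = spectrum.
  by rewrite /index_iota subn0.
have -> : (size spectrum)%:R * threshold = \sum_(r <- spectrum) threshold.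
  by rewrite big_const_seq count_predT iter_addr addr0 mulr_natl.
rewrite [leRHS]big_seq [leLHS]big_seq.
by apply: ler_sum => r; rewrite mem_filter => /andP[].
Qed.

(** The frequency 0 contributes [q^4] to the sum that counts representations. The
    other frequencies of the spectrum contribute nonnegative terms, and those
    outside the spectrum at most [threshold * M * q = q^4 / 2] in absolute value:
    the count cannot vanish. *)
Lemma bogolyubov_block (n : int) : (`|n| < 2 * q * B)%N ->
  (forall r, r \in spectrum -> 0 <= wave r n) ->
  exists i j k l, [/\ (i < q)%N, (j < q)%N, (k < q)%N, (l < q)%N &
    n = (a i)%:Z + (a j)%:Z - (a k)%:Z - (a l)%:Z].
Proof.
move=> nq hc; apply: contrapT => H.
have := sum_energy2_eq0 nq; have hn : forall i j k l, (i < q)%N -> (j < q)%N -> (k < q)%N ->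
    (l < q)%N -> n <> (a i)%:Z + (a j)%:Z - (a k)%:Z - (a l)%:Z.
  by move=> i j k l iq jq kq lq nE; apply: H; exists i, j, k, l.
move=> /(_ hn); apply/eqP; rewrite gt_eqF//.
have q0' : (0 : R) < q%:R by rewrite ltr0n.
have B0' : (0 : R) < B%:R by rewrite ltr0n.
have t0 : 0 < threshold by rewrite divr_gt0 ?exprn_gt0// mulr_gt0.
have lb r : (r < M)%N -> - (threshold * energy r) <= energy r ^+ 2 * wave r n.
  move=> rM; have [rt|rt] := leP threshold (energy r).
    apply: (@le_trans _ _ 0); first by rewrite oppr_le0 mulr_ge0 ?energy_ge0// ltW.
    by rewrite mulr_ge0 ?sqr_ge0// hc// mem_filter rt mem_iota.
  apply: (@le_trans _ _ (- (energy r ^+ 2))).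
    by rewrite lerN2 expr2 ler_wpM2r ?energy_ge0// ltW.
  rewrite -mulrN1 ler_wpM2l ?sqr_ge0//; exact: cos_geN1.
rewrite big_ltn// energy0 /wave mulr0 mul0r cos0 mulr1.
have lb' : - (threshold * (M%:R * q%:R)) <= \sum_(1 <= r < M) energy r ^+ 2 * wave r n.
  rewrite -sum_energy big_ltn// mulrDr opprD -[leRHS]add0r lerD//.
    by rewrite oppr_le0 mulr_ge0 ?energy_ge0// ltW.
  rewrite mulr_sumr -sumrN !big_nat; apply: ler_sum => r /andP[_ rM]; exact: lb.
apply: lt_le_trans (lerD (lexx _) lb').
have -> : threshold * (M%:R * q%:R) = (q%:R ^+ 2) ^+ 2 / 2.
  by rewrite /threshold /M !natrM; field; rewrite gt_eqF.
have : 0 < ((q%:R : R) ^+ 2) ^+ 2 by rewrite !exprn_gt0.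
move: ((q%:R : R) ^+ 2 ^+ 2) => y y0; lra.
Qed.

(** The frequencies of the spectrum, as points of the circle, are padded with 0 to
    a list whose length is independent of [q]. *)
Lemma bogolyubov_finite : exists theta : nat -> R, (forall i, 0 <= theta i <= 1) /\
  forall n : int, (`|n| < 2 * q * B)%N ->
  (forall i, (i < 32 * B ^ 2)%N -> 0 <= cos (pi *+ 2 * (theta i * n%:~R))) ->
  exists i j k l, n = (a i)%:Z + (a j)%:Z - (a k)%:Z - (a l)%:Z.
Proof.
have M0' : (0 : R) < M%:R by rewrite ltr0n.
exists (fun i => (nth 0%N spectrum i)%:R / M%:R); split.
  move=> i; rewrite divr_ge0//= ler_pdivrMr// mul1r ler_nat.
  have [ispec|ispec] := ltnP i (size spectrum); last by rewrite nth_default.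
  have := mem_nth 0%N ispec; rewrite mem_filter mem_iota => /andP[_ /andP[_ h]].
  exact: ltnW.
move=> n nq hn; have [|i [j [k [l [_ _ _ _ nE]]]]] := bogolyubov_block nq.
  move=> r rspec; have := hn (index r spectrum); rewrite nth_index// => /(_ _) h.
  rewrite /wave /w.
  suff -> : pi *+ 2 / M%:R * r%:R * n%:~R = pi *+ 2 * (r%:R / M%:R * n%:~R) :> R.
    by apply: h; apply: leq_trans size_spectrum; rewrite index_mem.
  by field; rewrite gt_eqF.
by exists i, j, k, l.
Qed.

End Bogolyubov.

Lemma filter_forall_seq (T : Type) (I : eqType) (G : set_system T) (FG : Filter G)
    (A : I -> set T) (s : seq I) :
  (forall i, i \in s -> G (A i)) -> G [set x | forall i, i \in s -> A i x].
Proof.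
elim: s => [|i s IHs] h; first by apply: (@filterS _ _ _ setT) => //; exact: filterT.
apply: (@filterS _ _ _ ([set x | forall i, i \in s -> A i x] `&` A i)).
  by move=> x [h1 h2] k; rewrite inE => /orP[/eqP ->|/h1].
apply: filterI; last by apply: h; rewrite inE eqxx.
by apply: IHs => k ks; apply: h; rewrite inE ks orbT.
Qed.

(** The frequencies found for the first [q] blocks have limits along an
    ultrafilter on [q]. Being close to integers is required with 1/4 and yields a
    positive cosine, an open condition on the frequency that some large [q]
    satisfies. *)
Lemma bogolyubov (R : realType) (E : set int) (B : nat) : (0 < B)%N ->
  (forall n : int, exists2 j : nat, (j < B)%N & E (n + j%:Z)) ->
  exists Theta : seq R, forall n : int,
    (forall theta, theta \in Theta -> near_int (1 / 4) (theta * n%:~R)) ->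
    exists a b c d, [/\ E a, E b, E c, E d & n = a + b - c - d].
Proof.
move=> B0 synd.
have /choice[a ha] : forall i, exists a : nat, (i * B <= a < i.+1 * B)%N /\ E a%:Z.
  move=> i; have [j jB Ej] := synd (i * B)%N%:Z; exists (i * B + j)%N.
  by rewrite PoszD; split => //; rewrite leq_addr mulSn addnC ltn_add2r.
have block i := (ha i).1.
have /choice[th hth] : forall q, exists theta : nat -> R, (forall i, 0 <= theta i <= 1) /\
  forall n : int, (`|n| < 2 * q.+1 * B)%N ->
  (forall i, (i < 32 * B ^ 2)%N -> 0 <= cos (pi *+ 2 * (theta i * n%:~R))) ->
  exists i j k l, n = (a i)%:Z + (a j)%:Z - (a k)%:Z - (a l)%:Z.
  by move=> q; exact: bogolyubov_finite.
have [G [UG ooG]] := @ultraFilterLemma nat \oo _.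
have PG : ProperFilter G by exact: ultra_proper.
have /choice[c hc] : forall i, exists c : R, forall e, 0 < e -> G [set q | `|th q i - c| < e].
  move=> i; have [c cl] := @compact_cluster01 R nat G (fun q => th q i) PG
    (fun q => (hth q).1 i).
  exists c => e e0; have [//|GC] := in_ultra_setVsetC [set q | `|th q i - c| < e] UG.
  by have [q qC qe] := cl _ _ GC e0.
exists [seq c i | i <- iota 0 (32 * B ^ 2)] => n hn.
have Gn : G [set q | forall i, i \in iota 0 (32 * B ^ 2) ->
    0 <= cos (pi *+ 2 * (th q i * n%:~R))].
  apply: filter_forall_seq => i im.
  have /cos_near_int ci : near_int (1 / 4) (c i * n%:~R).
    by apply: hn; exact: map_f.
  have cont : {for c i, continuous (fun t : R => cos (pi *+ 2 * (t * n%:~R)))}.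
    apply: continuous_comp; last exact: continuous_cos.
    by apply: cvgMr; apply: cvgMl; exact: cvg_id.
  have : nbhs (c i) [set t | 0 < cos (pi *+ 2 * (t * n%:~R))].
    by apply: (cont [set y | 0 < y]); exact: lt_nbhsr.
  move=> /nbhs_ballP[e /= e0 he].
  apply: filterS (hc i e e0) => q /= qe; apply: ltW; apply: he.
  by rewrite /ball /= distrC.
have Gq : G [set q | (`|n| < q)%N] by apply: ooG; exact: nbhs_infty_gt.
have [q [/= qn nq]] := filter_ex (filterI Gn Gq).
have [||i [j [k [l nE]]]] := (hth q).2 n; last 1 first.
- exists (a i)%:Z, (a j)%:Z, (a k)%:Z, (a l)%:Z.
  by split => //; exact: (ha _).2.
- by apply: leq_trans nq _; rewrite (leq_trans (leqnSn q))// -mulnA mulnCA leq_pmulr// muln_gt0.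
- by move=> i im; apply: qn; rewrite mem_iota.
Qed.

(** * Recurrence of polynomial phases *)

Section RealComplex.
Variable R : realType.

Lemma real_complex_continuous : continuous (real_complex R : R -> (R[i] : numFieldType)^o).
Proof.
move=> x A /nbhs_ballP [e /= e0 Be].
have /complex_realP [r rE] : e \is Num.real by exact: gtr0_real.
have r0 : 0 < r by rewrite -ltcR -rE.
apply/nbhs_ballP; exists r => //= y; rewrite /ball /= => xy; apply: Be.
rewrite /ball /= -rmorphB rE normc_def /= expr0n addr0 sqrtr_sqr.
by rewrite ltcR.
Qed.

Lemma real_complex_le1 (s : R) : 0 <= s <= 1 -> `|real_complex R s| <= 1.
Proof.
move=> /andP[s0 s1]; rewrite normc_def /= expr0n addr0 sqrtr_sqr ger0_norm//.
by rewrite (_ : 1 = (1 : R)%:C%C)// lecR.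
Qed.
End RealComplex.

Lemma near_int_sum (R : realType) (F : set_system nat) (fF : Filter F) (f : nat -> nat -> R) k :
  (forall i, (i < k)%N -> forall e, 0 < e -> F [set n | near_int e (f i n)]) ->
  forall e, 0 < e -> F [set n | near_int e (\sum_(i < k) f i n)].
Proof.
elim: k => [|k IHk] h e e0.
  apply: (@filterS _ _ _ setT); last exact: filterT.
  by move=> n _ /=; rewrite big_ord0; apply: near_int_lt; rewrite normr0.
have e2 : 0 < e / 2 by rewrite divr_gt0.
apply: (@filterS _ _ _ _ _ _
  (filterI (IHk (fun i ik => h i (ltnW ik)) _ e2) (h k (ltnSn k) _ e2))).
move=> n /= [h1 h2]; rewrite big_ord_recr /= (splitr e); exact: near_intD.
Qed.

Section Monomials.
Variables (R : realType) (K : numClosedFieldType) (X : topologicalLmodType K).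
Variables (iota : {rmorphism R -> K}).
Hypothesis iota_continuous : continuous (iota : R -> K^o).
Hypothesis iota_le1 : forall s, 0 <= s <= 1 -> `|iota s| <= 1.
Variables (T : {linear X -> X}) (T_continuous : continuous T).

Definition null_monomials (F : set_system nat) d (Theta : seq R) :=
  forall theta j e, theta \in Theta -> (0 < j <= d)%N -> 0 < e ->
    F [set n | near_int e (theta * n%:R ^+ j)].

Lemma recurrence_filter_top : recurrence_filter T [set A | A = setT].
Proof.
split.
- split => //; first by move=> A B -> ->; rewrite setTI.
  by move=> A B AB AT; apply/seteqP; split => // n _; apply: AB; rewrite AT.
- by move=> A ->.
- by move=> A ->; exists setT => // m _; apply/seteqP.
- move=> x HCx V oV V0 A ->.
  by have [z [Vz [n _ nE]]] := HCx V V0 oV; exists n => //; rewrite nE.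
Qed.

(** In [(n + m)^(d+1)] the mixed terms are integer multiples of [n^j] with
    [0 < j <= d], and the multipliers depend on [m] only. *)
Lemma monomial_almost_additive (F : set_system nat) (fF : Filter F) d (theta : R) :
  (forall j e, (0 < j <= d)%N -> 0 < e -> F [set n | near_int e (theta * n%:R ^+ j)]) ->
  almost_additive F (fun n => theta * n%:R ^+ d.+1).
Proof.
move=> h m e e0.
pose k i : int := (m ^ i.+1 * 'C(d.+1, i.+1))%N%:Z.
have -> : [set n : nat | near_int e (theta * (n + m)%:R ^+ d.+1 - theta * n%:R ^+ d.+1 -
    theta * m%:R ^+ d.+1)] =
  [set n : nat | near_int e (\sum_(i < d) (theta * n%:R ^+ (d - i)) *~ k i)].
  apply/funext => n /=; congr (near_int _ _).
  rewrite natrD exprDn big_ord_recl big_ord_recr /=.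
  rewrite subn0 expr0 mulr1 bin0 mulr1n /bump /= add1n subnn expr0 mul1r binn mulr1n.
  set b := \sum_(_ < _) _.
  have -> : theta * (n%:R ^+ d.+1 + (b + m%:R ^+ d.+1)) - theta * n%:R ^+ d.+1 -
    theta * m%:R ^+ d.+1 = theta * b by ring.
  rewrite mulr_sumr; apply: eq_bigr => i _.
  by rewrite /k /= add1n subSS -mulrzr -[X in _ = _ * X]/(_%:R) natrM natrX -mulr_natr; ring.
apply: (@near_int_sum R F fF (fun i n => (theta * n%:R ^+ (d - i)) *~ k i)) => // i id e1 e10.
set c := e1 / (`|k i| + 1)%:~R.
have c0 : 0 < c by rewrite divr_gt0// ltr0z; lia.
have := h (d - i)%N c; rewrite subn_gt0 id leq_subr => /(_ isT c0).
by apply: filterS => n; exact: near_intMz.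
Qed.

Lemma recurrence_filter_monomials d (Theta : seq R) :
  exists2 F, recurrence_filter T F & null_monomials F d Theta.
Proof.
elim: d => [|d [F0 gF0 nF0]].
  exists [set A | A = setT]; first exact: recurrence_filter_top.
  by move=> theta [].
suff : forall L : seq R, {subset L <= Theta} ->
    exists2 F, recurrence_filter T F & null_monomials F d Theta /\
    forall theta e, theta \in L -> 0 < e -> F [set n | near_int e (theta * n%:R ^+ d.+1)].
  move=> /(_ Theta) [//|F gF [n1 n2]]; exists F => // theta j e th.
  move=> /andP[j0]; rewrite leq_eqVlt ltnS => /orP[/eqP ->|jd] e0; first exact: n2.
  by apply: n1 => //; rewrite j0.
elim => [_|theta L IHL sub]; first by exists F0.
have [|F gF [n1 n2]] := IHL; first by move=> t tL; apply: sub; rewrite inE tL orbT.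
have th : theta \in Theta by apply: sub; rewrite inE eqxx.
have cF : almost_additive F (fun n => theta * n%:R ^+ d.+1).
  by apply: monomial_almost_additive; [exact: rf_filter gF|move=> j e jd e0; exact: n1].
have [|F' gF' [FF' psiF']] :=
  recurrence_filter_extend iota_continuous iota_le1 T_continuous gF cF _.
  by rewrite expr0n mulr0.
exists F' => //; split; first by move=> t j e tT jd e0; apply: FF'; exact: n1.
move=> t e; rewrite inE => /orP[/eqP ->|tL] e0; first exact: psiF'.
by apply: FF'; exact: n2.
Qed.

Lemma null_polynomial (F : set_system nat) (fF : Filter F) (Theta : seq R)
    (P : {poly int}) (e : R) :
  null_monomials F (size P) Theta -> P`_0 = 0 -> 0 < e ->
  forall theta, theta \in Theta -> F [set n | near_int e (theta * (P.[n%:Z])%:~R)].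
Proof.
move=> nF P0 e0 theta th.
have -> : [set n | near_int e (theta * (P.[n%:Z])%:~R)] =
  [set n : nat | near_int e (\sum_(i < size P) (theta * n%:R ^+ i) *~ P`_i)].
  apply/funext => n /=; congr (near_int _ _).
  rewrite horner_coef rmorph_sum mulr_sumr; apply: eq_bigr => i _.
  by rewrite rmorphM rmorphXn /= -mulrzr; ring.
apply: (@near_int_sum R F fF (fun i n => (theta * n%:R ^+ i) *~ P`_i)) => // i isz e1 e10.
have [->|i0] := posnP i.
  rewrite P0; apply: (@filterS _ _ _ setT); last exact: filterT.
  by move=> n _ /=; rewrite mulr0z; apply: near_int_lt; rewrite normr0.
set c := e1 / (`|P`_i| + 1)%:~R.
have c0 : 0 < c by rewrite divr_gt0// ltr0z; lia.
have := nF theta i c th; rewrite i0 ltnW// => /(_ isT c0).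
by apply: filterS => n; exact: near_intMz.
Qed.
End Monomials.

(** * Density in the product *)

Lemma nbhs0_sub (G : topologicalZmodType) (U : set G) : nbhs 0 U ->
  exists2 W : set G, nbhs 0 W & forall a b, W a -> W b -> U (a - b).
Proof.
move=> U0; have := @sub_continuous G (0, 0) U; rewrite /= subr0 => /(_ U0).
case=> -[W1 W2] [/= h1 h2] hW; exists (W1 `&` W2); first exact: filterI.
by move=> a b [Wa _] [_ Wb]; apply: (hW (a, b)).
Qed.

(** Translates of [W] by multiples of [g] cover [G], and by compactness finitely
    many of them do. *)
Lemma return_times_syndetic (G : topologicalZmodType) (g : G) (W : set G) :
  compact [set: G] -> dense (range (fun k : int => g *~ k)) -> nbhs 0 W ->
  exists2 B : nat, (0 < B)%N & forall n : int, exists2 j : nat, (j < B)%N & W (g *~ (n + j%:Z)).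
Proof.
move=> cG dg W0.
have ncov := (@compact_near_coveringP G setT).1 cG.
pose P (B : nat) (p : G) := exists2 k : int, (`|k| <= B)%N & W (p + g *~ k).
have hP (p : G) : [set: G] p -> \forall p' \near p & B \near \oo, P B p'.
  move=> _; have [||z [pz [k _ kE]]] := dg [set u | W° (u + p)].
  - by exists (- p); rewrite /= addNr; exact: nbhs_singleton (nbhs_interior W0).
  - have cp : continuous (fun u : G => u + p).
      by apply: continuous_add; [move=> ?; exact: cvg_id|exact: continuous_cst].
    have := @open_comp G G (fun u : G => u + p) W°; apply; last exact: open_interior.
    by move=> u _; exact: cp.
  exists ([set p' | W (p' + g *~ k)], [set B | (`|k| <= B)%N]).
    split; last exact: nbhs_infty_ge.
    by apply: nbhs_addr; rewrite addrC kE; exact: pz.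
  by move=> [p' B] /= [Wp kB]; exists k.
have := ncov nat \oo P _ hP => -[B _ hB].
exists (2 * B).+1 => // n.
have [k kB Wk] := hB B (leqnn B) (g *~ (n + B%:Z)) I.
exists (absz (B%:Z + k)); first lia.
have -> : n + (absz (B%:Z + k))%:Z = n + B%:Z + k by lia.
by rewrite mulrzDr.
Qed.

(* [topologicalZmodType] is the library's structure of abelian topological
   groups; it is written additively, so the power g^m is [g *~ m]. *)
Theorem theorem2p3 (R : realType) (X : topologicalLmodType R[i])
    (T : {linear X -> X}) (T_continuous : continuous T)
    (T_hypercyclic : hypercyclic T)
    (G : topologicalZmodType) (G_compact : compact [set: G])
    (P : {poly int}) (g : G)
    (gP_dense : dense [set g *~ P.[n%:Z] | n in [set n : nat | (1 <= n)%N]]) :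
  forall x : X, HC T x ->
    dense ([set (iter n T x, g *~ P.[n%:Z]) | n in [set n : nat | (1 <= n)%N]]
           : set (X * G)).
Proof.
move=> x HCx A [[y h] Ayh] oA.
have [[V U] /= [yV hU] VUA] : nbhs (y, h) A by apply: open_nbhs_nbhs.
have [|z [Uz [N /= N1 NE]]] := gP_dense U° _ (open_interior U).
  by exists h; exact: nbhs_singleton (nbhs_interior hU).
have [U1 U10 hU1] : exists2 U1 : set G, nbhs 0 U1 & forall u, U1 u -> U (u + z).
  by exists [set u | U (u + z)] => //; apply: nbhs_addr; rewrite add0r.
have [U2 U20 hU2] := nbhs0_sub U10.
have [W W0 hW] := nbhs0_sub U20.
have gZ : dense (range (fun k : int => g *~ k)).
  move=> D D0 oD; have [w [Dw [n _ nE]]] := gP_dense D D0 oD.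
  by exists w; split => //; exists P.[n%:Z].
have [B B0 synd] := return_times_syndetic G_compact gZ W0.
have [Th hTh] := @bogolyubov R [set k | W (g *~ k)] B B0 synd.
pose Q := P \Po ('X + N%:Z%:P) - (P.[N%:Z])%:P.
have QE (n : nat) : Q.[n%:Z] = P.[(n + N)%N%:Z] - P.[N%:Z].
  by rewrite /Q !hornerE horner_comp !hornerE PoszD.
have Q0 : Q`_0 = 0 by rewrite -horner_coef0 (QE 0%N) add0n subrr.
have [F gF nF] := @recurrence_filter_monomials R (R[i] : numClosedFieldType) X (real_complex R)
  (@real_complex_continuous R) (@real_complex_le1 R) T T_continuous (size Q) Th.
have fF := rf_filter gF.
have FA : F [set n | forall theta, theta \in Th -> near_int (1 / 4) (theta * (Q.[n%:Z])%:~R)].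
  apply: filter_forall_seq => theta th.
  by apply: (null_polynomial fF nF Q0 _ th); rewrite divr_gt0.
have HCN := @HC_iter (R[i] : numClosedFieldType) X T T_continuous x N HCx.
have [|n nA nV] := rf_hits gF HCN (open_interior V) _ FA.
  by exists y; exact: nbhs_singleton (nbhs_interior yV).
exists (iter (n + N) T x, g *~ P.[(n + N)%N%:Z]); split; last first.
  by exists (n + N)%N => //=; exact: leq_trans N1 (leq_addl _ _).
apply: (VUA (_, _)); split => /=; first by rewrite iterD; exact: interior_subset nV.
have [a [b [c [d [Wa Wb Wc Wd nE]]]]] := hTh _ nA.
have -> : P.[(n + N)%N%:Z] = (a - c) - (d - b) + P.[N%:Z].
  by rewrite -[LHS](subrK P.[N%:Z]) -QE nE; lia.
rewrite mulrzDr NE; apply: hU1; rewrite mulrzBr; apply: hU2.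
  by rewrite mulrzBr; exact: hW.
by rewrite mulrzBr; exact: hW.
Qed.
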